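(* Let $t$ and $d$ be integers with $2\le d\le t$, and let $H_t$ be the graph defined in the context. Then $$\mathrm{gp}_d(H_t)=\begin{cases} 4t, & d=t,\\ 4t+2, & d=t-1,\\ 5t-d+1, & \text{otherwise.}\end{cases}$$
   Context: Graphs are finite, simple, undirected. $d_G(u,w)$ denotes the shortest-path distance in a connected graph $G$, and $I_G(u,w)=\{x\in V(G): d_G(u,w)=d_G(u,x)+d_G(x,w)\}$. A set $S\subseteq V(G)$ is a general $d$-position set if for any three distinct vertices $u,v,w\in S$ with $v\in I_G(u,w)$ we have $d_G(u,w)>d$. $\mathrm{gp}_d(G)$ is the cardinality of a largest general $d$-position set of $G$. Construction of $H_t$: begin with a complete graph $K_{4t}$ with vertex set $A\cup B$, where $A$ and $B$ are disjoint and $|A|=|B|=2t$. Add a path $v_1v_2\ldots v_{t-1}$ on $t-1$ new vertices, and join every vertex of $B$ to $v_1$ by an edge. Then, for every $i\in\{2,\dots,t-1\}$, add a new vertex $u_i$ adjacent exactly to $v_i$ and $v_{i-1}$. (For $t=2$ there are no vertices $u_i$.) *)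

(* Defs.v *)
From HB Require Import structures.
From mathcomp Require Import all_boot.
Set Implicit Arguments.
Unset Strict Implicit.
Unset Printing Implicit Defensive.

Record sgraph := SGraph {
  vertex :> finType;
  adj : rel vertex;
  adj_sym : symmetric adj;
  adj_irr : irreflexive adj
}.

Definition connected (G : sgraph) : Prop :=
  forall x y : G, connect (@adj G) x y.

(* [walk n u w]: there is a walk with exactly [n] edges from [u] to [w]. *)
Definition walk (G : sgraph) (n : nat) (u w : G) : bool :=
  [exists p : n.-tuple G, path (@adj G) u p && (last u p == w)].

(* Least length of a walk.  A shortest walk has fewer than [#|G|] edges, so the
   search range is large enough; the value is the junk [#|G|] exactly when [u]
   and [w] are not connected. *)
Definition dist (G : sgraph) (u w : G) : nat :=
  find (fun n => walk n u w) (iota 0 #|G|).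

Lemma walk_dist (G : sgraph) (u w : G) :
  connect (@adj G) u w -> walk (dist u w) u w.
Proof.
case/connectP=> p0 Hp0 ->; case/shortenP: Hp0 => p Hp Up _.
have szp : size p < #|G| by have := max_card (mem (u :: p)); rewrite (card_uniqP Up).
have Hw : has (fun n => walk n u (last u p)) (iota 0 #|G|).
  apply/hasP; exists (size p); first by rewrite mem_iota.
  by apply/existsP; exists (in_tuple p); rewrite Hp eqxx.
have := nth_find 0 Hw; rewrite nth_iota ?add0n //.
by move: Hw; rewrite has_find size_iota.
Qed.

Lemma dist_le (G : sgraph) (u w : G) (n : nat) : walk n u w -> dist u w <= n.
Proof.
move=> Hw; rewrite leqNgt; apply/negP => lt_n.
have lt_nG : n < #|G|.
  apply: leq_trans lt_n _.
  by rewrite -[leqRHS](size_iota 0); apply: find_size.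
by have := before_find 0 lt_n; rewrite nth_iota // add0n Hw.
Qed.

Definition interval (G : sgraph) (u w : G) : {set G} :=
  [set x | dist u w == dist u x + dist x w].

Definition gp_set (G : sgraph) (d : nat) (S : {set G}) : bool :=
  [forall u in S, forall v in S, forall w in S,
     uniq [:: u; v; w] && (v \in interval u w) ==> (d < dist u w)].

Definition gp (G : sgraph) (d : nat) : nat :=
  \max_(S : {set G} | gp_set d S) #|S|.

(* Ordinals start at 0: [Vv i] is v_(i+1) and [Vu j] is u_(j+2). *)
Inductive Hvertex (t : nat) : Type :=
  | VA of 'I_(2 * t)
  | VB of 'I_(2 * t)
  | Vv of 'I_(t - 1)
  | Vu of 'I_(t - 2).

Definition Hvertex_code (t : nat) (x : Hvertex t) :
    ('I_(2 * t) + 'I_(2 * t)) + ('I_(t - 1) + 'I_(t - 2)) :=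
  match x with
  | VA a => inl (inl a)
  | VB b => inl (inr b)
  | Vv i => inr (inl i)
  | Vu j => inr (inr j)
  end.

Definition Hvertex_decode (t : nat)
    (c : ('I_(2 * t) + 'I_(2 * t)) + ('I_(t - 1) + 'I_(t - 2))) : Hvertex t :=
  match c with
  | inl (inl a) => VA a
  | inl (inr b) => VB b
  | inr (inl i) => Vv i
  | inr (inr j) => Vu j
  end.

Lemma Hvertex_codeK (t : nat) : cancel (@Hvertex_code t) (@Hvertex_decode t).
Proof. by case. Qed.

HB.instance Definition _ (t : nat) :=
  Finite.copy (Hvertex t) (can_type (@Hvertex_codeK t)).

Definition Hadj (t : nat) (x y : Hvertex t) : bool :=
  match x, y with
  | VA a, VA a' => a != a'
  | VB b, VB b' => b != b'
  | VA _, VB _ | VB _, VA _ => true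
  | VB _, Vv i | Vv i, VB _ => i == 0 :> nat
  | Vv i, Vv j => (j == i.+1 :> nat) || (i == j.+1 :> nat)
  (* u_(j+2) is adjacent to v_(j+1) and v_(j+2) *)
  | Vv i, Vu j | Vu j, Vv i => (i == j :> nat) || (i == j.+1 :> nat)
  | _, _ => false
  end.

Lemma Hadj_sym (t : nat) : symmetric (@Hadj t).
Proof. by case=> i [] j //=; rewrite 1?eq_sym // orbC. Qed.

Lemma Hadj_irr (t : nat) : irreflexive (@Hadj t).
Proof. by case=> i //=; rewrite ?eqxx // orbb; elim: (i : nat). Qed.

Definition Hgraph (t : nat) : sgraph :=
  @SGraph (Hvertex t) (@Hadj t) (@Hadj_sym t) (@Hadj_irr t).

Lemma Hgraph_connected (t : nat) (ht : 2 <= t) : connected (Hgraph t).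
Proof.
have t1 : 0 < t - 1 by rewrite subn_gt0.
have t2 : 0 < 2 * t by rewrite muln_gt0 (ltn_trans _ ht).
pose r : Hgraph t := Vv (Ordinal t1).
have csym : connect_sym (@adj (Hgraph t)) by apply/sym_connect_sym/adj_sym.
have cv n (hn : n < t - 1) : connect (@adj (Hgraph t)) r (Vv (Ordinal hn)).
  elim: n hn => [|n IH] hn.
    by rewrite (_ : Ordinal hn = Ordinal t1) //; apply: val_inj.
  apply: connect_trans (IH (ltnW hn)) (connect1 _).
  by rewrite /= eqxx.
have cb b : connect (@adj (Hgraph t)) r (VB b) by apply: connect1.
have cr x : connect (@adj (Hgraph t)) r x.
  case: x => [a|b|[n hn]|j] //.
  - by apply: connect_trans (cb (Ordinal t2)) (connect1 _).
  - have hj : j < t - 1 by apply: leq_trans (ltn_ord j) (leq_sub2l _ _).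
    by apply: connect_trans (cv j hj) (connect1 _); rewrite /= eqxx.
by move=> x y; apply: connect_trans (cr y); rewrite csym.
Qed.

(* Main.v *)
Require Import Defs.
From HB Require Import structures.
From mathcomp Require Import all_boot.
From mathcomp Require Import zify.
Set Implicit Arguments.
Unset Strict Implicit.
Unset Printing Implicit Defensive.

(** The graph H_t is an interval graph.  Give every vertex of A the interval
    [0,0], every vertex of B the interval [0,1], the vertex v_i the interval
    [i,i+1] and the vertex u_i the interval [i,i]; two distinct vertices are
    then adjacent exactly when their intervals meet ([adjE]).  Consequently the
    distance between distinct vertices is one plus the gap between their
    intervals ([dist_neq]), because the unit intervals of B and of the path
    v_1 ... v_(t-1) fill any gap one unit per step.  From there on, betweenness
    is arithmetic on endpoints.

    Upper bound.  A general d-position set S that misses A or misses B has at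
    most 2t + (2t - 3) elements, which is below the claimed value.  Otherwise S
    contains some a in A and b in B, and since b lies between a and every vertex
    x of the tail (the v_i and u_i), x must start at position at least d: it is
    a v_i or u_i with d <= i <= t-1.  The part of the tail in S then injects
    into the t-d+1 integers d, ..., t ([slot_inj]): send each vertex to its
    left endpoint, except that v_i is sent to i+1 if u_i is also in S.  If u_i
    and v_i are both in S, nothing in S starts at i+1, since v_i would be
    between u_i and such a vertex, at distance 2 <= d.

    Lower bound.  All of A and B together with u_d, ..., u_(t-1) and v_(t-1)
    is in general d-position when d < t ([extremal_gp]): an inner vertex of a
    geodesic has a unit interval, so here it belongs to B, and the ends of the
    geodesic are then a vertex of A and a tail vertex at position at least d.
    For d = t the tail contributes nothing.  The value is thus 4t + (t-d+1) for
    d < t, which for d = t-1 reads 4t + 2. *)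

(** * Distances and general position in a graph *)

Lemma walk0 (G : sgraph) (u w : G) : walk 0 u w = (u == w).
Proof.
apply/existsP/eqP => [[p]|->]; first by rewrite (tuple0 p) => /eqP.
by exists [tuple]; rewrite /= eqxx.
Qed.

Lemma walkS (G : sgraph) (n : nat) (u w : G) :
  walk n.+1 u w = [exists z, adj u z && walk n z w].
Proof.
apply/existsP/existsP => [[p]|[z /andP[uz /existsP[p zp]]]].
  case/tupleP: p => z p /= /andP[/andP[uz zp] pw].
  by exists z; rewrite uz; apply/existsP; exists p; rewrite zp.
by exists [tuple of z :: p]; rewrite /= uz.
Qed.

Lemma walk_connect (G : sgraph) (n : nat) (u w : G) :
  walk n u w -> connect (@adj G) u w.
Proof.
by case/existsP=> p /andP[up /eqP <-]; apply/connectP; exists p.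
Qed.

(** The distance is the only function vanishing exactly on the diagonal that
    grows by at most one along an edge and can always be decreased by one by moving to a neighbour:
    the Lipschitz bound makes it at most the length of any walk, and repeated
    descent builds a walk of that length. *)
Lemma dist_unique (G : sgraph) (f : G -> G -> nat) :
    (forall x y, (f x y == 0) = (x == y)) ->
    (forall x z y, adj x z -> f x y <= (f z y).+1) ->
    (forall x y, x != y -> exists2 z, adj x z & f x y = (f z y).+1) ->
  forall x y, dist x y = f x y.
Proof.
move=> f0 f_lip f_step.
have f_le n x y : walk n x y -> f x y <= n.
  elim: n x => [|n IHn] x; first by rewrite walk0 -f0 => /eqP->.
  rewrite walkS => /existsP[z /andP[xz zy]].
  by apply: leq_trans (f_lip x z y xz) _; rewrite ltnS IHn.
have f_walk n x y : f x y = n -> walk n x y.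
  elim: n x => [|n IHn] x fxy; first by rewrite walk0 -f0 fxy.
  have [|z xz fz] := f_step x y; first by rewrite -f0 fxy.
  rewrite walkS; apply/existsP; exists z; rewrite xz IHn //.
  by apply: succn_inj; rewrite -fz.
move=> x y; have xy := f_walk _ x y erefl.
by apply/eqP; rewrite eqn_leq dist_le //= f_le // walk_dist // (walk_connect xy).
Qed.

Lemma gp_setP (G : sgraph) (d : nat) (S : {set G}) :
  reflect (forall u v w, u \in S -> v \in S -> w \in S ->
             u != v -> v != w -> u != w ->
             dist u w = dist u v + dist v w -> d < dist u w)
          (gp_set d S).
Proof.
apply: (iffP forall_inP) => [gpS u v w uS vS wS uv vw uw duw|gpS u uS].
  have/forall_inP/(_ v vS)/forall_inP/(_ w wS)/implyP := gpS u uS.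
  by apply; rewrite /= !inE negb_or uv uw vw /= duw.
apply/forall_inP=> v vS; apply/forall_inP=> w wS; apply/implyP.
rewrite /= !inE negb_or andbT => /andP[/andP[/andP[uv uw] vw] /eqP].
exact: gpS.
Qed.

(** * The interval model of the graph *)

Section Model.
Variable t : nat.
Implicit Types x y z : Hgraph t.

Definition lo (x : Hgraph t) : nat :=
  match x with VA _ | VB _ => 0 | Vv i => i.+1 | Vu j => j.+2 end.

Definition hi (x : Hgraph t) : nat :=
  match x with VA _ => 0 | VB _ => 1 | Vv i => i.+2 | Vu j => j.+2 end.

Lemma lo_hi_bounds x :
  [/\ lo x <= hi x, hi x <= (lo x).+1, hi x <= t & lo x < t].
Proof. by case: x => i /=; have := ltn_ord i; split; lia. Qed.

Lemma adjE x y : adj x y = [&& x != y, lo x <= hi y & lo y <= hi x].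
Proof.
rewrite -(inj_eq (can_inj (@Hvertex_codeK t))).
by case: x => i; case: y => j //=; have := ltn_ord i; have := ltn_ord j;
   rewrite ?(inj_eq inr_inj) ?(inj_eq inl_inj) ?(inj_eq inr_inj) -?val_eqE /=; lia.
Qed.

(** Fails at [lo x = 0], where the vertices of A (and likewise those of B) all
    share one interval. *)
Lemma tail_inj x y : 0 < lo x -> lo x = lo y -> hi x = hi y -> x = y.
Proof.
case: x => i; case: y => j //= _ [ij] [hij]; try lia;
  by congr (_ _); apply: val_inj.
Qed.

(** Unit intervals leave no hole between 0 and t; these vertices are the steps
    from which geodesics are made. *)
Lemma link_exists p : p < t -> exists z, lo z = p /\ hi z = p.+1.
Proof.
case: p => [t0|p pt].
  have h : 0 < 2 * t by lia.
  by exists (VB (Ordinal h)).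
have h : p < t - 1 by lia.
by exists (Vv (Ordinal h)).
Qed.

Definition interval_dist x y : nat :=
  if x == y then 0 else ((lo y - hi x) + (lo x - hi y)).+1.

Lemma distE x y : dist x y = interval_dist x y.
Proof.
move: x y; apply: dist_unique => [x y|x z y|x y]; rewrite /interval_dist.
- by case: (x == y).
- rewrite adjE => /and3P[_ xz zx]; have [<-|_] := eqVneq x y => //.
  have [zy|_] := eqVneq z y; first by move: xz zx; rewrite zy; lia.
  have [] := lo_hi_bounds x; have [] := lo_hi_bounds y.
  have [] := lo_hi_bounds z; lia.
move=> xy; rewrite (negPf xy).
have [x1 x2 x3 x4] := lo_hi_bounds x; have [y1 y2 y3 y4] := lo_hi_bounds y.
(* A neighbour z of x is a step towards y as soon as its interval differs from
   those of x and y and leaves a gap to y that is one unit shorter. *)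
have step z : lo z <= hi x -> lo x <= hi z ->
    hi z <> hi x \/ lo z <> lo x -> hi z <> hi y \/ lo z <> lo y ->
    lo y - hi x + (lo x - hi y) = (lo y - hi z + (lo z - hi y)).+1 ->
  exists2 z0, adj x z0 & (lo y - hi x + (lo x - hi y)).+1
    = (if z0 == y then 0 else (lo y - hi z0 + (lo z0 - hi y)).+1).+1.
  move=> zx xz nzx nzy e; exists z.
    rewrite adjE zx xz !andbT; apply/eqP => xz'; rewrite xz' in nzx; lia.
  have -> : z == y = false by apply/eqP => zy'; rewrite zy' in nzy; lia.
  by rewrite e.
have [xy_lt|yx] := ltnP (hi x) (lo y).
  have [|z [lz hz]] := @link_exists (hi x); first lia.
  by apply: (step z); lia.
have [yx_lt|xy'] := ltnP (hi y) (lo x).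
  have [|z [lz hz]] := @link_exists (lo x).-1; first lia.
  by apply: (step z); lia.
exists y; first by rewrite adjE xy xy' yx.
by rewrite eqxx; lia.
Qed.

Lemma dist_neq x y : x != y -> dist x y = ((lo y - hi x) + (lo x - hi y)).+1.
Proof. by rewrite distE /interval_dist => /negPf->. Qed.

(** * Counting vertices *)

Lemma card_Hgraph_set (S : {set Hgraph t}) :
  #|S| = #|[set i | VA i \in S]| + #|[set i | VB i \in S]|
       + (#|[set i | Vv i \in S]| + #|[set j | Vu j \in S]|).
Proof.
have decodeK : cancel (@Hvertex_decode t) (@Hvertex_code t) by do 2 case.
have bij : bijective (@Hvertex_decode t).
  by exists (@Hvertex_code t) => //; apply: Hvertex_codeK.
rewrite -!sum1_card (reindex (@Hvertex_decode t)); last exact: onW_bij.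
rewrite !big_sumType /=.
by do ![congr (_ + _)]; apply: eq_bigl => i; rewrite !inE.
Qed.

Lemma card_ord_geq n m : #|[set i : 'I_n | m <= i]| = n - m.
Proof.
rewrite -sum1_card -[RHS]muln1 -sum_nat_const_nat big_geq_mkord.
by apply: eq_bigl => i; rewrite inE.
Qed.

(** * Upper bound *)

Section Tail.
Variables (d : nat) (S : {set Hgraph t}).
Hypotheses (d2 : 2 <= d) (gpS : gp_set d S).

(** Here b lies between a and x, whose distance is [(lo x).+1]. *)
Lemma gp_tail_far a b x :
  VA a \in S -> VB b \in S -> x \in S -> 0 < lo x -> d <= lo x.
Proof.
move=> aS bS xS x0.
have ax : VA a != x by apply/eqP => e; move: x0; rewrite -e.
have bx : VB b != x by apply/eqP => e; move: x0; rewrite -e.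
have ab : VA a != VB b :> Hgraph t by [].
have := gp_setP _ _ gpS _ _ _ aS bS xS ab bx ax.
rewrite !dist_neq //=; lia.
Qed.

(** The integer charged to a tail vertex: its left endpoint, or the right one
    for v_i when u_i, whose interval is the point i, already occupies i. *)
Definition slot x : nat :=
  if (lo x < hi x) && [exists y in S, (lo y == lo x) && (hi y == lo x)]
  then hi x else lo x.

(** A tail vertex is determined by its interval, so only a v_i displaced to
    i+1 by u_i could collide, with a vertex of S starting at i+1; the three of
    them would form a geodesic of length 2. *)
Lemma slot_inj x y : x \in S -> y \in S -> 0 < lo x -> 0 < lo y ->
  slot x = slot y -> x = y.
Proof.
have moved_collide z w : z \in S -> w \in S -> 0 < lo z ->
    lo z < hi z -> [exists y in S, (lo y == lo z) && (hi y == lo z)] ->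
  hi z <> lo w.
  move=> zS wS z0 zlt /exists_inP[u uS /andP[/eqP lu /eqP hu]] zw.
  have [w1 w2 w3 w4] := lo_hi_bounds w; have [z1 z2 z3 z4] := lo_hi_bounds z.
  have uz : u != z by apply/eqP => e; rewrite e in hu; lia.
  have uw : u != w by apply/eqP => e; rewrite e in hu; lia.
  have zw' : z != w by apply/eqP => e; rewrite e in zlt zw; lia.
  have := gp_setP _ _ gpS _ _ _ uS zS wS uz zw' uw.
  rewrite !dist_neq //; lia.
have kept_eq z w : z \in S -> w \in S -> 0 < lo z -> lo z = lo w ->
   slot z = lo z -> slot w = lo w -> z = w.
  rewrite /slot => zS wS z0 zw sz sw; apply: tail_inj => //.
  have [w1 w2 _ _] := lo_hi_bounds w; have [z1 z2 _ _] := lo_hi_bounds z.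
  have [e|nz] := eqVneq (lo z) (hi z); have [e'|nw] := eqVneq (lo w) (hi w);
    try lia.
    move: sw; rewrite ltn_neqAle nw w1 /= ifT; first lia.
    by apply/exists_inP; exists z => //; lia.
  move: sz; rewrite ltn_neqAle nz z1 /= ifT; first lia.
  by apply/exists_inP; exists w => //; lia.
move=> xS yS x0 y0.
have := kept_eq x y xS yS x0; rewrite /slot.
have [w1 w2 _ _] := lo_hi_bounds x; have [z1 z2 _ _] := lo_hi_bounds y.
case: ifP => [/andP[x1 x2]|_]; case: ifP => [/andP[y1 y2]|_] kept e.
- by apply: tail_inj => //; lia.
- by case: (moved_collide x y xS yS x0 x1 x2).
- by case: (moved_collide y x yS xS y0 y1 y2).
- exact: kept.
Qed.

(** The slots used lie between d and t; for d >= t no left endpoint is large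
    enough. *)
Lemma card_tail_le :
  (forall x, x \in S -> 0 < lo x -> d <= lo x) ->
  #|[set x in S | 0 < lo x]| <= if d < t then t - d + 1 else 0.
Proof.
move=> far; set T := [set x in S | _].
case: ifP => [dt|/negbT dt]; last first.
  rewrite leqn0 cards_eq0; apply/eqP/setP => x; rewrite !inE.
  apply/negP => /andP[xS x0].
  by have := far x xS x0; have [] := lo_hi_bounds x; lia.
have slot_lt x : slot x < t.+1.
  by rewrite /slot ltnS; case: ifP => _; have [] := lo_hi_bounds x; lia.
pose g x := Ordinal (slot_lt x).
have gT : {in T &, injective g}.
  move=> x y; rewrite !inE => /andP[xS x0] /andP[yS y0] [].
  exact: slot_inj.
have -> : t - d + 1 = t.+1 - d by lia.
rewrite -(card_in_imset gT) -card_ord_geq; apply/subset_leq_card/subsetP => i.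
case/imsetP=> x; rewrite !inE => /andP[xS x0] -> /=; rewrite /slot.
by have := far x xS x0; have [] := lo_hi_bounds x; case: ifP; lia.
Qed.

Lemma card_gp_set_le : 2 <= t ->
  #|S| <= 4 * t + if d < t then t - d + 1 else 0.
Proof.
move=> t2; have cle n (P : pred 'I_n) : #|[set i | P i]| <= n.
  by apply: leq_trans (max_card _) _; rewrite card_ord.
have := card_Hgraph_set S.
have := cle _ (fun i => VA i \in S); have := cle _ (fun i => VB i \in S).
have := cle _ (fun i => Vv i \in S); have := cle _ (fun i => Vu i \in S).
(* Without A, or without B, the other parts have at most
   2t + (t-1) + (t-2) < 4t vertices altogether. *)
have [->|[a aS]] := set_0Vmem [set i | VA i \in S]; first by rewrite cards0; lia.
have [->|[b bS]] := set_0Vmem [set i | VB i \in S]; first by rewrite cards0; lia.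
rewrite !inE in aS bS.
have := card_tail_le (fun x => gp_tail_far aS bS (x := x)).
rewrite (card_Hgraph_set [set x in S | 0 < lo x]).
have -> : [set i | Vv i \in [set x in S | 0 < lo x]] = [set i | Vv i \in S].
  by apply/setP => i; rewrite !inE andbT.
have -> : [set i | Vu i \in [set x in S | 0 < lo x]] = [set i | Vu i \in S].
  by apply/setP => i; rewrite !inE andbT.
lia.
Qed.

End Tail.

(** * Lower bound *)

(** The set A, B, u_d, ..., u_(t-1), v_(t-1), the tail part being present only
    for d < t; for t >= 2, v_(t-1) is the one vertex whose interval ends at t. *)
Definition extremal_set d : {set Hgraph t} :=
  [set x | (lo x == 0) || [&& d < t, d <= lo x & (lo x == hi x) || (hi x == t)]].

(** If v is strictly between u and w, the interval of v has length 1 and lies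
    in the gap from u to w.  It cannot be that of v_(t-1), after which nothing
    starts, so v is in B, u say is in A, and w starts at some i >= d and is at
    distance i+1 from u. *)
Lemma extremal_gp d : gp_set d (extremal_set d).
Proof.
apply/gp_setP => u v w; rewrite !inE => uS vS wS uv vw uw.
rewrite !dist_neq //.
have [] := lo_hi_bounds u; have [] := lo_hi_bounds v; have [] := lo_hi_bounds w.
lia.
Qed.

Lemma card_extremal d : 2 <= d ->
  #|extremal_set d| = 4 * t + if d < t then t - d + 1 else 0.
Proof.
move=> d2; rewrite card_Hgraph_set.
have -> : [set i | VA i \in extremal_set d] = setT.
  by apply/setP => i; rewrite !inE.
have -> : [set i | VB i \in extremal_set d] = setT.
  by apply/setP => i; rewrite !inE.
rewrite !cardsT card_ord.
case: ifP => dt; last first.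
  have -> : [set i | Vv i \in extremal_set d] = set0.
    by apply/setP => i; rewrite !inE dt.
  have -> : [set i | Vu i \in extremal_set d] = set0.
    by apply/setP => i; rewrite !inE dt.
  by rewrite !cards0; lia.
have -> : [set i | Vv i \in extremal_set d] = [set i : 'I_(t - 1) | t - 2 <= i].
  by apply/setP => i; rewrite !inE /= dt; have := ltn_ord i; lia.
have -> : [set i | Vu i \in extremal_set d] = [set i : 'I_(t - 2) | d - 2 <= i].
  by apply/setP => i; rewrite !inE /= dt; have := ltn_ord i; lia.
by rewrite !card_ord_geq; lia.
Qed.

End Model.

(** * The value of the general d-position number *)

Theorem proposition2p1 (t d : nat) (hd : 2 <= d) (hdt : d <= t) :
  gp (Hgraph t) d =
    if d == t then 4 * t
    else if d == t - 1 then 4 * t + 2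
    else 5 * t - d + 1.
Proof.
transitivity (4 * t + if d < t then t - d + 1 else 0); last first.
  by case: (ltnP d t); case: eqP; try case: eqP; lia.
apply/eqP; rewrite eqn_leq; apply/andP; split.
  apply/bigmax_leqP => S gpS.
  by apply: card_gp_set_le; last exact: leq_trans hdt.
by rewrite -card_extremal //; apply: leq_bigmax_cond; apply: extremal_gp.
Qed.
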